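(* Let $\mathbb K$ be a field of characteristic $0$ and let $\mathfrak L=\mathfrak g\times\mathbb K$ be the product of a Lie algebra $\mathfrak g$ over $\mathbb K$ and the field $\mathbb K=\langle t\rangle$ considered as the trivial one-dimensional Lie algebra. Suppose that $\mathcal Z(\mathfrak g)=0$ and $(\Lambda^2\mathfrak g)^{\mathfrak g}=0$. Then the Lie bialgebra structures on $\mathfrak L$ are determined by pairs $(\delta_{\mathfrak g},D)$, where $\delta_{\mathfrak g}$ is a Lie bialgebra structure on $\mathfrak g$ and $D\in\mathrm{BiDer}(\mathfrak g,\delta_{\mathfrak g})$. The Lie cobracket on $\mathfrak L$ is explicitly given by $\delta(x)=\delta_{\mathfrak g}(x)+D(x)\wedge t$ for any $x\in\mathfrak g$, and $\delta(t)=0$.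
   Context: A Lie bialgebra over $\mathbb K$ is a Lie algebra $\mathfrak g$ with a linear map (Lie cobracket) $\delta\colon\mathfrak g\to\Lambda^2\mathfrak g$ which satisfies co-Jacobi ($\mathrm{Alt}((\delta\otimes\mathrm{id})\circ\delta)=0$) and is a 1-cocycle: $\delta[x,y]=\mathrm{ad}_x\delta(y)-\mathrm{ad}_y\delta(x)$. $\mathcal Z(\mathfrak g)$ is the center and $(\Lambda^2\mathfrak g)^{\mathfrak g}$ the space of $\mathrm{ad}$-invariants. A biderivation of $(\mathfrak g,\delta)$ is a linear map $D\colon\mathfrak g\to\mathfrak g$ that is a derivation of the Lie algebra and a coderivation, i.e. $(D\otimes\mathrm{id}+\mathrm{id}\otimes D)\circ\delta=\delta\circ D$; $\mathrm{BiDer}(\mathfrak g,\delta)$ is the set of biderivations. *)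

(* Defs.v *)
From HB Require Import structures.
From mathcomp Require Import all_boot all_algebra sesquilinear.
From mathcomp Require Import boolp classical_sets.

Set Implicit Arguments.
Unset Strict Implicit.
Unset Printing Implicit Defensive.

Import GRing.Theory.
Local Open Scope quotient_scope.
Local Open Scope ring_scope.

(* The tensor product of two vector spaces of arbitrary dimension: finite
   formal sums of pairs (x, y), two of them being identified when every
   bilinear map takes the same value on them.  The universal property is
   [tlift_linear], [tliftE] and [tlift_uniq]. *)
Section Tensor.
Variables (K : fieldType) (V W : lmodType K).

Definition formal_eval (U : lmodType K) (b : V -> W -> U) (s : seq (V * W)) : U :=
  \sum_(p <- s) b p.1 p.2.

Definition formal_eq (s s' : seq (V * W)) : bool :=
  `[< forall (U : lmodType K) (b : V -> W -> U),
        bilinear_for *:%R *:%R b -> formal_eval b s = formal_eval b s' >].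

Lemma formal_eq_refl : reflexive formal_eq.
Proof. by move=> s; apply/asboolP. Qed.

Lemma formal_eq_sym : symmetric formal_eq.
Proof. by move=> s s'; apply/asboolP/asboolP => h U b bb; rewrite h. Qed.

Lemma formal_eq_trans : transitive formal_eq.
Proof.
move=> s2 s1 s3 /asboolP h12 /asboolP h23; apply/asboolP => U b bb.
by rewrite h12 // h23.
Qed.

Canonical formal_equiv :=
  EquivRel formal_eq formal_eq_refl formal_eq_sym formal_eq_trans.

Definition tensor : Type := {eq_quot formal_eq}.

HB.instance Definition _ := Choice.on tensor.

Definition tclass (s : seq (V * W)) : tensor := \pi_({eq_quot formal_eq}) s.

Definition tpure (x : V) (y : W) : tensor := tclass [:: (x, y)].

(* Outside bilinear maps [b] the value of [tlift b] is irrelevant. *)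
Definition tlift (U : lmodType K) (b : V -> W -> U) (u : tensor) : U :=
  formal_eval b (repr (u : {eq_quot formal_eq})).

Lemma tclassP (s s' : seq (V * W)) :
  tclass s = tclass s' <->
  forall (U : lmodType K) (b : V -> W -> U),
    bilinear_for *:%R *:%R b -> formal_eval b s = formal_eval b s'.
Proof.
split=> [/eqP|h]; first by rewrite /tclass eqmodE => /asboolP.
by apply/eqP; rewrite /tclass eqmodE; apply/asboolP.
Qed.

Lemma tclass_repr (u : tensor) : tclass (repr (u : {eq_quot formal_eq})) = u.
Proof. exact: reprK. Qed.

Lemma tensor_ind (P : tensor -> Prop) : (forall s, P (tclass s)) -> forall u, P u.
Proof. by move=> h u; rewrite -[u]tclass_repr. Qed.

Lemma tlift_class (U : lmodType K) (b : V -> W -> U) s :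
  bilinear_for *:%R *:%R b -> tlift b (tclass s) = formal_eval b s.
Proof. by move=> bb; apply: (tclassP _ _).1 bb; rewrite tclass_repr. Qed.

Definition formal_scale (a : K) (s : seq (V * W)) := [seq (a *: p.1, p.2) | p <- s].

Lemma formal_eval_cat (U : lmodType K) (b : V -> W -> U) s s' :
  formal_eval b (s ++ s') = formal_eval b s + formal_eval b s'.
Proof. by rewrite /formal_eval big_cat. Qed.

Lemma formal_eval_scale (U : lmodType K) (b : V -> W -> U) a s :
  bilinear_for *:%R *:%R b -> formal_eval b (formal_scale a s) = a *: formal_eval b s.
Proof.
move=> bb; rewrite /formal_eval big_map scaler_sumr; apply: eq_bigr => p _.
exact: (scalable_linear (bb.1 p.2) a p.1).
Qed.

Definition tadd (u v : tensor) : tensor :=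
  tclass (repr (u : {eq_quot formal_eq}) ++ repr (v : {eq_quot formal_eq})).
Definition tscale (a : K) (u : tensor) : tensor :=
  tclass (formal_scale a (repr (u : {eq_quot formal_eq}))).

Lemma tadd_class s s' : tadd (tclass s) (tclass s') = tclass (s ++ s').
Proof.
apply/tclassP => U b bb; rewrite !formal_eval_cat.
by congr (_ + _); apply: (tclassP _ _).1 bb; rewrite tclass_repr.
Qed.

Lemma tscale_class a s : tscale a (tclass s) = tclass (formal_scale a s).
Proof.
apply/tclassP => U b bb; rewrite !formal_eval_scale //.
by congr (_ *: _); apply: (tclassP _ _).1 bb; rewrite tclass_repr.
Qed.

Lemma taddA : associative tadd.
Proof.
elim/tensor_ind=> s1; elim/tensor_ind=> s2; elim/tensor_ind=> s3.
by rewrite !tadd_class catA.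
Qed.

Lemma taddC : commutative tadd.
Proof.
elim/tensor_ind=> s1; elim/tensor_ind=> s2; rewrite !tadd_class.
by apply/tclassP => U b bb; rewrite !formal_eval_cat addrC.
Qed.

Lemma tadd0 : left_id (tclass [::]) tadd.
Proof. by elim/tensor_ind=> s; rewrite tadd_class. Qed.

Lemma taddN : left_inverse (tclass [::]) (tscale (- 1)) tadd.
Proof.
elim/tensor_ind=> s; rewrite tscale_class tadd_class.
apply/tclassP => U b bb; rewrite formal_eval_cat formal_eval_scale //.
by rewrite scaleN1r addNr /formal_eval big_nil.
Qed.

HB.instance Definition _ := GRing.isZmodule.Build tensor taddA taddC tadd0 taddN.

Lemma tclassD s s' : tclass s + tclass s' = tclass (s ++ s').
Proof. exact: tadd_class. Qed.

Lemma tscaleA a b u : tscale a (tscale b u) = tscale (a * b) u.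
Proof.
elim/tensor_ind: u => s; rewrite !tscale_class; apply/tclassP => U c cc.
by rewrite !formal_eval_scale // scalerA.
Qed.

Lemma tscale1 : left_id 1 tscale.
Proof.
elim/tensor_ind=> s; rewrite tscale_class; apply/tclassP => U c cc.
by rewrite formal_eval_scale // scale1r.
Qed.

Lemma tscaleDr : right_distributive tscale +%R.
Proof.
move=> a; elim/tensor_ind=> s; elim/tensor_ind=> s'.
rewrite tclassD !tscale_class tclassD; apply/tclassP => U c cc.
by rewrite formal_eval_cat !formal_eval_scale // formal_eval_cat scalerDr.
Qed.

Lemma tscaleDl u : {morph tscale^~ u : a b / a + b}.
Proof.
move=> a b; elim/tensor_ind: u => s; rewrite !tscale_class tclassD.
apply/tclassP => U c cc.
by rewrite formal_eval_cat !formal_eval_scale // scalerDl.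
Qed.

HB.instance Definition _ :=
  GRing.Zmodule_isLmodule.Build K tensor tscaleA tscale1 tscaleDr tscaleDl.

Lemma tclassZ a s : a *: tclass s = tclass (formal_scale a s).
Proof. exact: tscale_class. Qed.

Lemma tpure_bilinear : bilinear_for *:%R *:%R tpure.
Proof.
split=> [y a x x'|x a y y'] /=; rewrite /tpure tclassZ tclassD.
  apply/tclassP => U b bb; rewrite formal_eval_cat formal_eval_scale //.
  by rewrite /formal_eval !big_seq1 /= bb.1.
apply/tclassP => U b bb; rewrite formal_eval_cat formal_eval_scale //.
by rewrite /formal_eval !big_seq1 /= bb.2.
Qed.

Lemma tlift_linear (U : lmodType K) (b : V -> W -> U) :
  bilinear_for *:%R *:%R b -> linear (tlift b).
Proof.
move=> bb a; elim/tensor_ind=> s; elim/tensor_ind=> s'.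
rewrite tclassZ tclassD !tlift_class //.
by rewrite formal_eval_cat formal_eval_scale.
Qed.

Lemma tliftE (U : lmodType K) (b : V -> W -> U) x y :
  bilinear_for *:%R *:%R b -> tlift b (tpure x y) = b x y.
Proof. by move=> bb; rewrite tlift_class // /formal_eval big_seq1. Qed.

Lemma tensor_sum (u : tensor) : exists s : seq (V * W), u = \sum_(p <- s) tpure p.1 p.2.
Proof.
elim/tensor_ind: u => s; exists s; elim: s => [|[x y] s IHs]; first by rewrite big_nil.
by rewrite big_cons -IHs tclassD.
Qed.

Lemma tlift_uniq (U : lmodType K) (b : V -> W -> U) (f : tensor -> U) :
  bilinear_for *:%R *:%R b -> linear f -> (forall x y, f (tpure x y) = b x y) ->
  f =1 tlift b.
Proof.
move=> bb lf fE u; have [s ->] := tensor_sum u.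
have lt := tlift_linear bb.
have f0 (g : tensor -> U) : linear g -> g 0 = 0.
  by move=> lg; rewrite -(subrr 0) (zmod_morphism_linear lg) subrr.
have fD (g : tensor -> U) : linear g -> {morph g : x y / x + y}.
  by move=> lg x y; have := lg 1 x y; rewrite !scale1r.
rewrite (big_morph f (fD f lf) (f0 f lf)) (big_morph _ (fD _ lt) (f0 _ lt)).
by apply: eq_bigr => p _; rewrite fE tliftE.
Qed.

End Tensor.

Notation "x \ox y" := (tpure x y) (at level 40, left associativity) : ring_scope.

Section TensorMaps.
Variable K : fieldType.

Definition tmap (V W V' W' : lmodType K) (f : V -> V') (g : W -> W') :
    tensor V W -> tensor V' W' :=
  tlift (fun x y => f x \ox g y).

Lemma tmap_bilinear (V W V' W' : lmodType K) (f : V -> V') (g : W -> W') :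
  linear f -> linear g -> bilinear_for *:%R *:%R (fun x y => f x \ox g y).
Proof.
move=> lf lg; split=> [y a x x'|x a y y'] /=.
  by rewrite lf (tpure_bilinear _ _).1.
by rewrite lg (tpure_bilinear _ _).2.
Qed.

Lemma tmap_linear (V W V' W' : lmodType K) (f : V -> V') (g : W -> W') :
  linear f -> linear g -> linear (tmap f g).
Proof. by move=> lf lg; apply/tlift_linear/tmap_bilinear. Qed.

Lemma tmapE (V W V' W' : lmodType K) (f : V -> V') (g : W -> W') x y :
  linear f -> linear g -> tmap f g (x \ox y) = f x \ox g y.
Proof. by move=> lf lg; rewrite /tmap tliftE //; apply: tmap_bilinear. Qed.

Variable V : lmodType K.

(* Normalised without the factor 1/2; likewise [alternation] below carries no
   factor 1/6. *)
Definition wedge (x y : V) : tensor V V := x \ox y - y \ox x.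

(* The exterior square, realised inside the tensor square as the span of the
   x /\ y (scalars are absorbed in the first factor). *)
Definition exterior_square : set (tensor V V) :=
  [set u | exists s : seq (V * V), u = \sum_(p <- s) wedge p.1 p.2].

Definition alt3 (x y z : V) : tensor (tensor V V) V :=
  x \ox y \ox z - y \ox x \ox z + y \ox z \ox x
  - z \ox y \ox x + z \ox x \ox y - x \ox z \ox y.

(* Alt, the signed sum over all six permutations of the three factors; see
   [alternationE]. *)
Definition alternation : tensor (tensor V V) V -> tensor (tensor V V) V :=
  tlift (fun u z => tlift (fun x y => alt3 x y z) u).

Lemma linear_tpurel (U W W' : lmodType K) (f : U -> W) (y : W') :
  linear f -> linear (fun x => f x \ox y).
Proof. by move=> lf a x x'; rewrite lf (tpure_bilinear _ _).1. Qed.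

Lemma linear_tpurer (U W W' : lmodType K) (f : U -> W) (y : W') :
  linear f -> linear (fun x => y \ox f x).
Proof. by move=> lf a x x'; rewrite lf (tpure_bilinear _ _).2. Qed.

Lemma linear_add (U W : lmodType K) (f g : U -> W) :
  linear f -> linear g -> linear (fun x => f x + g x).
Proof. by move=> lf lg a x y; rewrite lf lg scalerDr addrACA. Qed.

Lemma linear_sub (U W : lmodType K) (f g : U -> W) :
  linear f -> linear g -> linear (fun x => f x - g x).
Proof. by move=> lf lg a x y; rewrite lf lg scalerBr opprD addrACA. Qed.

Ltac linear_comb := first
  [ by move=> ? ? ?
  | apply: linear_sub; linear_comb | apply: linear_add; linear_comb
  | apply: linear_tpurel; linear_comb | apply: linear_tpurer; linear_comb ].

Lemma alt3_linear1 y z : linear (fun x => alt3 x y z).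
Proof. rewrite /alt3; linear_comb. Qed.

Lemma alt3_linear2 x z : linear (fun y => alt3 x y z).
Proof. rewrite /alt3; linear_comb. Qed.

Lemma alt3_linear3 x y : linear (alt3 x y).
Proof. rewrite /alt3; linear_comb. Qed.

Lemma alt3_bilinear12 z : bilinear_for *:%R *:%R (fun x y => alt3 x y z).
Proof. by split=> [y|x]; [apply: alt3_linear1 | apply: alt3_linear2]. Qed.

Lemma alternation_bilinear :
  bilinear_for *:%R *:%R (fun u z => tlift (fun x y => alt3 x y z) u).
Proof.
split=> [z|u a z z'] /=; first exact/tlift_linear/alt3_bilinear12.
rewrite /tlift /formal_eval scaler_sumr -big_split /=.
by apply: eq_bigr => p _; rewrite alt3_linear3.
Qed.

Lemma alternation_linear : linear alternation.
Proof. exact/tlift_linear/alternation_bilinear. Qed.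

Lemma alternationE x y z : alternation (x \ox y \ox z) = alt3 x y z.
Proof.
rewrite /alternation tliftE; last exact: alternation_bilinear.
by rewrite tliftE //; apply: alt3_bilinear12.
Qed.

End TensorMaps.

HB.mixin Record isLieAlgebra (K : fieldType) V of GRing.Lmodule K V := {
  lie : V -> V -> V;
  lie_bilinear : bilinear_for *:%R *:%R lie;
  liexx : forall x, lie x x = 0;
  lie_jacobi : forall x y z, lie x (lie y z) + lie y (lie z x) + lie z (lie x y) = 0
}.

#[short(type="lieAlgType")]
HB.structure Definition LieAlgebra (K : fieldType) :=
  {V of isLieAlgebra K V & GRing.Lmodule K V}.

Section TrivialLie.
Variable K : fieldType.

Definition trivial_lie (x y : K^o) : K^o := 0.

Lemma trivial_lie_bilinear : bilinear_for *:%R *:%R trivial_lie.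
Proof. by split=> [y|x] a u v; rewrite /trivial_lie /= scaler0 addr0. Qed.

Lemma trivial_liexx x : trivial_lie x x = 0.
Proof. by []. Qed.

Lemma trivial_lie_jacobi x y z :
  trivial_lie x (trivial_lie y z) + trivial_lie y (trivial_lie z x)
  + trivial_lie z (trivial_lie x y) = 0.
Proof. by rewrite /trivial_lie !addr0. Qed.

(* K^o, the field as a vector space over itself, is the trivial
   one-dimensional Lie algebra. *)
HB.instance Definition _ :=
  isLieAlgebra.Build K K^o trivial_lie_bilinear trivial_liexx trivial_lie_jacobi.

End TrivialLie.

Section ProductLie.
Variables (K : fieldType) (g h : lieAlgType K).

Definition prod_lie (x y : g * h) : g * h := (lie x.1 y.1, lie x.2 y.2).

Lemma prod_lie_bilinear : bilinear_for *:%R *:%R prod_lie.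
Proof.
by split=> [y|x] a u v; rewrite /prod_lie /= !(lie_bilinear.1, lie_bilinear.2).
Qed.

Lemma prod_liexx x : prod_lie x x = 0.
Proof. by rewrite /prod_lie !liexx. Qed.

Lemma prod_lie_jacobi x y z :
  prod_lie x (prod_lie y z) + prod_lie y (prod_lie z x) + prod_lie z (prod_lie x y) = 0.
Proof. by congr pair; rewrite /= lie_jacobi. Qed.

HB.instance Definition _ :=
  isLieAlgebra.Build K (g * h)%type prod_lie_bilinear prod_liexx prod_lie_jacobi.

End ProductLie.

Section LieBialgebra.
Variables (K : fieldType) (g : lieAlgType K).

Definition lie_center : set g := [set z | forall x, lie z x = 0].

Definition ad2 (x : g) : tensor g g -> tensor g g :=
  fun u => tmap (lie x) id u + tmap id (lie x) u.

Definition ext_invariants : set (tensor g g) :=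
  [set u | exterior_square u /\ forall x, ad2 x u = 0].

Record lie_bialgebra (delta : g -> tensor g g) : Prop := LieBialgebra {
  cobracket_linear : linear delta;
  cobracket_ext : forall x, exterior_square (delta x);
  co_jacobi : forall x, alternation (tmap delta id (delta x)) = 0;
  cobracket_cocycle :
    forall x y, delta (lie x y) = ad2 x (delta y) - ad2 y (delta x)
}.

Record biderivation (delta : g -> tensor g g) (D : g -> g) : Prop := Biderivation {
  bider_linear : linear D;
  bider_derivation : forall x y, D (lie x y) = lie (D x) y + lie x (D y);
  bider_coderivation :
    forall x, tmap D id (delta x) + tmap id D (delta x) = delta (D x)
}.

Definition trivial_ext : lieAlgType K := (g * K^o)%type.

(* The inclusion of g in g x K, and the generator t of the factor K. *)
Definition incl (x : g) : trivial_ext := (x, 0).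
Definition gen_t : trivial_ext := (0, 1).

End LieBialgebra.

Arguments trivial_ext {K} g.
Arguments gen_t {K g}.
Arguments lie_center {K} g.
Arguments ext_invariants {K} g.

(* Main.v *)
Require Import Defs.
From mathcomp Require Import all_boot all_algebra.
From mathcomp Require Import boolp classical_sets.

(** Write [L = g x K], with projections [p : L -> g] and [z |-> z.2], inclusion
    [i : g -> L] and central generator [t].  The exterior square of [L] is the
    direct sum of that of [g] and of a copy of [g], embedded by
    [v |-> i v /\ t]; the components of [u] are [(p (x) p) u] and the
    contraction [contract_t u] of the second tensor factor along the coordinate
    of [t] ([exterior_split], [split_fst], [split_contract]).  Both components
    are equivariant for the adjoint action, because [t] is central and is never
    a component of a bracket.

    Since [t] is central, the cocycle condition applied to [[z, t] = 0] says
    that [delta t] is invariant.  Its two components are then an invariant of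
    the exterior square of [g] and a central element of [g], hence both zero:
    [delta t = 0] ([cobracket_gen_t]).  So a cobracket on [L] amounts to the
    pair [(dg, D)] of components of [delta (i x)], and the cocycle condition for
    [delta] amounts to the cocycle condition for [dg] together with the fact
    that [D] is a derivation.

    The co-Jacobi identity splits in the same way ([co_jacobi_ext]): with [J w]
    the alternation of [(i (x) i) w (x) t], the co-Jacobi tensor of [delta] at
    [i x] is the image of that of [dg] at [x] plus
    [J (dg (D x) - (D (x) 1 + 1 (x) D) (dg x))].  This proves at once that the
    pairs in question give Lie bialgebras.  Conversely [p (x) p (x) p] kills [J]
    and recovers the first summand, while contracting the third factor along [t]
    kills the first summand and turns [J w] into [w - flip w], which is [2 w]
    for antisymmetric [w]; as 2 is invertible, both summands vanish, so [dg]
    satisfies co-Jacobi and [D] is a coderivation. *)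

Set Implicit Arguments.
Unset Strict Implicit.
Unset Printing Implicit Defensive.

Import GRing.Theory.
Local Open Scope classical_set_scope.
Local Open Scope ring_scope.

(** * Linear maps and tensors *)

Section LinearMaps.
Variables (K : fieldType) (U V W : lmodType K).

Lemma linear_id : linear (fun x : V => x).
Proof. by []. Qed.

Lemma linear_fst : linear (@fst U V).
Proof. by []. Qed.

Lemma linear_comp (f : U -> V) (g : V -> W) :
  linear f -> linear g -> linear (fun x => g (f x)).
Proof. by move=> lf lg a x y; rewrite lf lg. Qed.

Lemma linear_opp (f : U -> V) : linear f -> linear (fun x => - f x).
Proof. by move=> lf a x y; rewrite lf opprD scalerN. Qed.

Variables (f : U -> V) (lf : linear f).

Lemma lin0 : f 0 = 0.
Proof. by rewrite -(subrr 0) (zmod_morphism_linear lf) subrr. Qed.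

Lemma linD : {morph f : x y / x + y}.
Proof. by move=> x y; have := lf 1 x y; rewrite !scale1r. Qed.

Lemma linB : {morph f : x y / x - y}.
Proof. exact: zmod_morphism_linear. Qed.

Lemma linN : {morph f : x / - x}.
Proof. by move=> x; rewrite -sub0r linB lin0 sub0r. Qed.

Lemma linZ a x : f (a *: x) = a *: f x.
Proof. exact: scalable_linear. Qed.

Lemma lin_sum I (s : seq I) (F : I -> U) : f (\sum_(i <- s) F i) = \sum_(i <- s) f (F i).
Proof. exact: (big_morph f linD lin0). Qed.

End LinearMaps.

Lemma linear_lier (K : fieldType) (g : lieAlgType K) (x : g) : linear (lie x).
Proof. exact: lie_bilinear.2. Qed.

Lemma linear_incl (K : fieldType) (g : lieAlgType K) : linear (@incl K g).
Proof. by move=> a x y; congr pair; rewrite /= scaler0 addr0. Qed.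

Lemma ad2_linear (K : fieldType) (g : lieAlgType K) (x : g) : linear (ad2 x).
Proof. by apply: linear_add; apply: tmap_linear => //; apply: linear_lier. Qed.

Section Wedge.
Variables (K : fieldType) (V : lmodType K).

Lemma wedge_linearl (y : V) : linear (fun x => wedge x y).
Proof. by apply: linear_sub; [apply: linear_tpurel | apply: linear_tpurer]. Qed.

Lemma wedge_linearr (x : V) : linear (fun y => wedge x y).
Proof. by apply: linear_sub; [apply: linear_tpurer | apply: linear_tpurel]. Qed.

End Wedge.

(* Linearity of a composite is proved by recursion on its outermost operation.
   Sums and pure tensors come before the generic composition case, whose
   pattern would also match them. *)
Ltac lin := cbn beta; first
  [ assumption
  | exact: linear_id | exact: linear_fst | exact: linear_incl
  | exact: linear_lier | exact: ad2_linear | exact: alternation_linear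
  | exact: wedge_linearl | exact: wedge_linearr
  | exact: (tpure_bilinear _ _).1 | exact: (tpure_bilinear _ _).2
  | lazymatch goal with
    | |- linear (fun x => - @?f x) => apply: (linear_opp (f := f)); lin
    | |- linear (fun x => @?f x - @?g x) => apply: (linear_sub (f := f) (g := g)); lin
    | |- linear (fun x => @?f x + @?g x) => apply: (linear_add (f := f) (g := g)); lin
    | |- linear (fun x => tpure (@?f x) ?y) => apply: (linear_tpurel (f := f)); lin
    | |- linear (fun x => tpure ?y (@?f x)) => apply: (linear_tpurer (f := f)); lin
    | |- linear (tmap _ _) => apply: tmap_linear; lin
    | |- linear (fun x => wedge (@?f x) ?y) =>
        apply: (linear_comp (f := f) (g := fun z => wedge z y)); lin
    | |- linear (fun x => ?h (@?f x)) => apply: (linear_comp (f := f) (g := h)); lin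
    | |- ?G => fail 0 G
    end ].

Section TensorExt.
Variable K : fieldType.

(** The uniqueness half of the universal property; identities between linear
    maps on tensors are proved below by checking them on pure tensors. *)
Lemma tensor_linP (V W U : lmodType K) (f h : tensor V W -> U) :
  linear f -> linear h -> (forall x y, f (x \ox y) = h (x \ox y)) -> f =1 h.
Proof.
move=> lf lh fh.
have bb : bilinear_for *:%R *:%R (fun x y => h (x \ox y)).
  by split=> [y|x]; simpl; lin.
by move=> u; rewrite (tlift_uniq bb lf fh) -(tlift_uniq bb lh).
Qed.

Lemma tensor3_linP (V W X U : lmodType K) (f h : tensor (tensor V W) X -> U) :
  linear f -> linear h ->
  (forall x y z, f (x \ox y \ox z) = h (x \ox y \ox z)) -> f =1 h.
Proof.
move=> lf lh fh; apply: tensor_linP => // u z.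
apply: (tensor_linP (f := fun u => f (u \ox z)) (h := fun u => h (u \ox z))) => //; lin.
Qed.

Lemma tpureDl (V W : lmodType K) (x y : V) (z : W) :
  (x + y) \ox z = x \ox z + y \ox z.
Proof. by apply: (linD (f := fun x => x \ox z)); lin. Qed.

Lemma tpureBl (V W : lmodType K) (x y : V) (z : W) :
  (x - y) \ox z = x \ox z - y \ox z.
Proof. by apply: (linB (f := fun x => x \ox z)); lin. Qed.

Lemma tpure0l (V W : lmodType K) (z : W) : (0 : V) \ox z = 0.
Proof. by apply: (lin0 (f := fun x : V => x \ox z)); lin. Qed.

Lemma tpure0r (V W : lmodType K) (z : V) : z \ox (0 : W) = 0.
Proof. by apply: (lin0 (f := fun x : W => z \ox x)); lin. Qed.

Lemma tmap_comp (V W V' W' V'' W'' : lmodType K) (f : V -> V') (h : W -> W')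
    (f' : V' -> V'') (h' : W' -> W'') u :
  linear f -> linear h -> linear f' -> linear h' ->
  tmap f' h' (tmap f h u) = tmap (fun x => f' (f x)) (fun y => h' (h y)) u.
Proof.
move=> lf lh lf' lh'; move: u; apply: tensor_linP => [||x y]; try lin.
by rewrite !tmapE //; lin.
Qed.

Lemma tmap_id (V W : lmodType K) (u : tensor V W) : tmap (fun x => x) (fun y => y) u = u.
Proof.
by apply: (tensor_linP (h := fun u => u)) u => [||x y]; [lin | lin | rewrite tmapE].
Qed.

Variable V : lmodType K.

(** * The exterior square and alternation *)

Definition flip : tensor V V -> tensor V V := tlift (fun x y => y \ox x).

Let flip_bilinear : bilinear_for *:%R *:%R (fun x y : V => y \ox x).
Proof. by split=> [y|x]; lin. Qed.

Lemma flip_linear : linear flip.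
Proof. exact: tlift_linear. Qed.

Lemma flipE x y : flip (x \ox y) = y \ox x.
Proof. exact: tliftE. Qed.

Lemma flip_ext u : exterior_square u -> flip u = - u.
Proof.
case=> s ->; rewrite (lin_sum flip_linear) -sumrN; apply: eq_bigr => p _.
by rewrite /wedge (linB flip_linear) !flipE opprB.
Qed.

Lemma exterior_squareD (u v : tensor V V) :
  exterior_square u -> exterior_square v -> exterior_square (u + v).
Proof. by case=> s -> [s' ->]; exists (s ++ s'); rewrite big_cat. Qed.

Lemma exterior_square_wedge (x y : V) : exterior_square (wedge x y).
Proof. by exists [:: (x, y)]; rewrite big_seq1. Qed.

Lemma tmap_wedge (W : lmodType K) (f : V -> W) x y :
  linear f -> tmap f f (wedge x y) = wedge (f x) (f y).
Proof. by move=> lf; rewrite /wedge (linB (tmap_linear lf lf)) !tmapE. Qed.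

Lemma exterior_square_tmap (W : lmodType K) (f : V -> W) u :
  linear f -> exterior_square u -> exterior_square (tmap f f u).
Proof.
move=> lf [s ->]; exists [seq (f p.1, f p.2) | p <- s].
rewrite big_map (lin_sum (tmap_linear lf lf)); apply: eq_bigr => p _.
exact: tmap_wedge.
Qed.

Lemma alt3_swap12 (x y z : V) : alt3 y x z = - alt3 x y z.
Proof. by rewrite /alt3 !(opprD, opprK) [LHS](ACl (2*1*6*5*4*3)). Qed.

Lemma alt3_swap23 (x y z : V) : alt3 x z y = - alt3 x y z.
Proof. by rewrite /alt3 !(opprD, opprK) [LHS](ACl (6*5*4*3*2*1)). Qed.

(** Over an arbitrary field this does not follow from antisymmetry: the six
    terms have to be cancelled in pairs. *)
Lemma alt3xx (x y : V) : alt3 x y y = 0.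
Proof. by rewrite /alt3 addrK subrK subrr. Qed.

Lemma alternation_tmap (W : lmodType K) (f : V -> W) w : linear f ->
  alternation (tmap (tmap f f) f w) = tmap (tmap f f) f (alternation w).
Proof.
move=> lf; move: w; apply: tensor3_linP => [||x y z]; try lin.
have lF : linear (tmap (tmap f f) f) by lin.
have FE a b c : tmap (tmap f f) f (a \ox b \ox c) = f a \ox f b \ox f c.
  by rewrite !tmapE //; lin.
by rewrite FE !alternationE /alt3 !(linB lF, linD lF) !FE.
Qed.

End TensorExt.

Section CoderivSum.
Variables (K : fieldType) (V : lmodType K) (D : V -> V) (lD : linear D).

Lemma tmap_flip u : flip (tmap D id u) = tmap id D (flip u).
Proof.
have lf := flip_linear (V := V); move: u; apply: tensor_linP => [||x y]; try lin.
by rewrite flipE !tmapE // flipE.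
Qed.

Lemma tmap_flipr u : flip (tmap id D u) = tmap D id (flip u).
Proof.
have lf := flip_linear (V := V); move: u; apply: tensor_linP => [||x y]; try lin.
by rewrite flipE !tmapE // flipE.
Qed.

End CoderivSum.

Section LieMorphism.
Variable K : fieldType.

Lemma lie_anti (g : lieAlgType K) (x y : g) : lie y x = - lie x y.
Proof.
have := liexx (x + y).
have lr z : linear (fun x : g => lie x z) by exact: lie_bilinear.1.
rewrite (linD (lr _)) !(linD (linear_lier _)) !liexx add0r addr0 => /eqP.
by rewrite addrC addr_eq0 => /eqP.
Qed.

(** The projection [g x K -> g] is such a morphism, which is how invariants and
    cocycles on the extension descend to [g]. *)
Lemma ad2_tmap (g h : lieAlgType K) (f : g -> h) x u :
  linear f -> (forall x y, f (lie x y) = lie (f x) (f y)) ->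
  tmap f f (ad2 x u) = ad2 (f x) (tmap f f u).
Proof.
move=> lf fl; move: u; apply: tensor_linP => [||a b]; rewrite /ad2; try lin.
have lF : linear (tmap f f) by lin.
by rewrite (linD lF) !tmapE ?fl //; lin.
Qed.

End LieMorphism.

(** * The exterior square of the trivial extension *)

Section Extension.
Variables (K : fieldType) (g : lieAlgType K).
Local Notation L := (trivial_ext g).
Local Notation i := (@incl K g).
Local Notation p := (@fst g K^o : L -> g).
Local Notation t := (@gen_t K g).

Lemma extE (z : L) : z = i z.1 + (z.2 : K) *: t.
Proof.
case: z => x a; congr pair; first by rewrite /= scaler0 addr0.
by rewrite /= add0r; symmetry; apply: mulr1.
Qed.

Lemma tmap_fst_incl u : tmap p p (tmap i i u) = u.
Proof. by rewrite tmap_comp; [exact: tmap_id | lin..]. Qed.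

(** The map [1 (x) tau], where [tau] is the coordinate of [t], followed by the
    identification of [g (x) K] with [g]; it reads off [v] from [i v /\ t]. *)
Definition contract_t : tensor L L -> g := tlift (fun x y : L => (y.2 : K) *: x.1).

Let contract_bilinear : bilinear_for *:%R *:%R (fun x y : L => (y.2 : K) *: x.1).
Proof.
split=> [y|x] a u v /=; first by rewrite scalerDr scalerA mulrC -scalerA.
by rewrite scalerDl scalerA.
Qed.

Lemma contract_linear : linear contract_t.
Proof. exact: tlift_linear. Qed.

Lemma contractE x y : contract_t (x \ox y) = (y.2 : K) *: x.1.
Proof. exact: tliftE. Qed.

Lemma contract_wedge (x y : L) :
  contract_t (wedge x y) = (y.2 : K) *: x.1 - (x.2 : K) *: y.1.
Proof. by rewrite /wedge (linB contract_linear) !contractE. Qed.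

Lemma contract_incl u : contract_t (tmap i i u) = 0.
Proof.
have lc := contract_linear.
move: u; apply: (tensor_linP (h := fun=> 0)) => [||x y]; try lin.
- by move=> a u v; rewrite scaler0 addr0.
- by rewrite tmapE ?contractE ?scale0r //; lin.
Qed.

Lemma wedge_ext (z w : L) :
  wedge z w =
  tmap i i (wedge z.1 w.1) + wedge (i ((w.2 : K) *: z.1 - (z.2 : K) *: w.1)) t.
Proof.
have lt : linear (fun z : L => wedge z t) by lin.
have lti : linear (fun x => wedge (i x) t) by lin.
have lw z' := wedge_linearr (z' : L); have lz w' := wedge_linearl (w' : L).
rewrite [in LHS](extE z) [in LHS](extE w) tmap_wedge; last by lin.
rewrite (linD (lz _)) !(linD (lw _)) !(linZ (lz _)).
rewrite !(linZ (lw _)) (linB lti) !(linZ lti).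
by rewrite [wedge t t]subrr !scaler0 addr0 -addrA -scalerN /wedge opprB.
Qed.

(** The decomposition of the exterior square of [g x K] announced above.  It
    holds because both sides are linear in [u] and agree on wedges, where it is
    the expansion of [(x + a t) /\ (y + b t)] using [t /\ t = 0]. *)
Lemma exterior_split u : exterior_square u ->
  u = tmap i i (tmap p p u) + wedge (i (contract_t u)) t.
Proof.
have lc := contract_linear.
case=> s ->.
set F := fun u => tmap i i (tmap p p u) + wedge (i (contract_t u)) t.
have lF : linear F by rewrite /F; lin.
rewrite -/(F _) (lin_sum lF); apply: eq_bigr => q _; rewrite /F.
by rewrite contract_wedge tmap_wedge ?[LHS]wedge_ext //; lin.
Qed.

Lemma split_fst u v : tmap p p (tmap i i u + wedge (i v) t) = u.
Proof.
have lP : linear (tmap p p) by lin.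
rewrite (linD lP) tmap_fst_incl tmap_wedge //= /wedge tpure0l tpure0r.
by rewrite subrr addr0.
Qed.

Lemma split_contract u v : contract_t (tmap i i u + wedge (i v) t) = v.
Proof.
rewrite (linD contract_linear) contract_incl contract_wedge /=.
by rewrite scale1r scale0r subr0 add0r.
Qed.

Lemma ad2_incl (z : L) u : ad2 z (tmap i i u) = tmap i i (ad2 z.1 u).
Proof.
move: u; apply: tensor_linP => [||a b]; try lin.
have lI : linear (tmap i i) by lin.
rewrite tmapE; try lin.
by rewrite /ad2 (linD lI) !tmapE //; lin.
Qed.

Lemma ad2_wedge_t (z : L) v : ad2 z (wedge (i v) t) = wedge (i (lie z.1 v)) t.
Proof.
have z_t : lie z t = 0 by congr pair; apply: (lin0 (linear_lier _)).
rewrite /wedge (linB (ad2_linear _)) /ad2 !tmapE; try lin.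
by rewrite z_t tpure0l tpure0r addr0 add0r.
Qed.

(** Only [ad_z (x) 1] contributes: brackets have no component along [t], so the
    contraction kills the image of [1 (x) ad_z]. *)
Lemma contract_ad2 (z : L) u : contract_t (ad2 z u) = lie z.1 (contract_t u).
Proof.
have lc := contract_linear.
move: u; apply: tensor_linP => [||a b]; try lin.
rewrite /ad2 (linD contract_linear) !tmapE ?contractE; try lin.
have lz := linear_lier z.1.
by rewrite /= scale0r addr0 (linZ lz).
Qed.

(** * The co-Jacobi identity on the trivial extension *)

(** This carries the exterior square of [g] to the part of the third exterior
    power of [g x K] that involves [t]. *)
Definition alt_t (w : tensor g g) : tensor (tensor L L) L :=
  alternation (tmap i i w \ox t).

Lemma alt_t_linear : linear alt_t.
Proof. by rewrite /alt_t; lin. Qed.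

Lemma alt_tE a b : alt_t (a \ox b) = alt3 (i a) (i b) t.
Proof. by rewrite /alt_t tmapE ?alternationE //; lin. Qed.

Lemma alt_t_flip w : alt_t (flip w) = - alt_t w.
Proof.
have lf := @flip_linear K g; have lJ := alt_t_linear.
move: w; apply: tensor_linP => [||a b]; try lin.
by rewrite flipE !alt_tE alt3_swap12.
Qed.

(** Contraction of the third factor along the coordinate of [t], and projection
    of the first two factors to [g]. *)
Definition contract3_t : tensor (tensor L L) L -> tensor g g :=
  tlift (fun (w : tensor L L) (z : L) => (z.2 : K) *: tmap p p w).

Let contract3_bilinear :
  bilinear_for *:%R *:%R (fun (w : tensor L L) (z : L) => (z.2 : K) *: tmap p p w).
Proof.
have lp : linear (tmap p p) by lin.
split=> [z|w] a u v /=.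
  by rewrite lp scalerDr scalerA mulrC -scalerA.
by rewrite scalerDl scalerA.
Qed.

Lemma contract3_linear : linear contract3_t.
Proof. exact: tlift_linear. Qed.

Lemma contract3E x y z : contract3_t (x \ox y \ox z) = (z.2 : K) *: (x.1 \ox y.1).
Proof. by rewrite /contract3_t tliftE // tmapE. Qed.

(** Of the six terms of the alternation of [a (x) b (x) t], two have [t] in the
    last position, with opposite signs. *)
Lemma contract3_alt_t w : contract3_t (alt_t w) = w - flip w.
Proof.
have lf := @flip_linear K g; have lJ := alt_t_linear; have lc := contract3_linear.
move: w; apply: tensor_linP => [||a b]; try lin.
rewrite alt_tE flipE /alt3 !(linB lc, linD lc) !contract3E /=.
by rewrite !scale0r !scale1r !subr0 !addr0.
Qed.

Lemma contract3_incl w : contract3_t (tmap (tmap i i) i w) = 0.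
Proof.
have lc := contract3_linear.
move: w; apply: (tensor3_linP (h := fun=> 0)) => [||a b c]; try lin.
- by move=> a u v; rewrite scaler0 addr0.
- by rewrite !tmapE ?contract3E /= ?scale0r //; lin.
Qed.

Lemma fst3_incl w : tmap (tmap p p) p (tmap (tmap i i) i w) = w.
Proof.
move: w; apply: (tensor3_linP (h := fun w => w)) => [||a b c]; try lin.
by rewrite !tmapE //; lin.
Qed.

Lemma fst3_alt_t w : tmap (tmap p p) p (alt_t w) = 0.
Proof.
rewrite /alt_t -alternation_tmap ?tmapE; try lin.
by rewrite tpure0r (lin0 (@alternation_linear _ _)).
Qed.

Section CoJacobi.
Variables (dg : g -> tensor g g) (D : g -> g) (delta : L -> tensor L L).
Hypotheses (ldg : linear dg) (lD : linear D) (ldelta : linear delta).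
Hypothesis dg_ext : forall x, exterior_square (dg x).
Hypothesis delta_incl :
  forall x, delta (i x) = tmap i i (dg x) + wedge (i (D x)) t.
Hypothesis delta_t : delta t = 0.

(** [(delta (x) 1) (a (x) b)] contributes the term [(D a /\ t) (x) b], which is
    [wedge_slot (D a (x) b)]. *)
Definition wedge_slot : tensor g g -> tensor (tensor L L) L :=
  tmap (fun a => wedge (i a) t) i.

Lemma wedge_slot_linear : linear wedge_slot.
Proof. by rewrite /wedge_slot; lin. Qed.

(** Moving [t] to the last position costs one transposition in
    [a (x) t (x) b] and two in [t (x) a (x) b], which enters with a minus sign;
    both terms thus give [- alt_t (a (x) b)]. *)
Lemma alternation_wedge_slot w : alternation (wedge_slot w) = - (alt_t w + alt_t w).
Proof.
have lJ := alt_t_linear; have lw := wedge_slot_linear.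
move: w; apply: tensor_linP => [||a b]; try lin.
rewrite /wedge_slot tmapE; try lin.
rewrite /wedge tpureBl (linB (@alternation_linear _ _)) !alternationE alt_tE.
by rewrite (alt3_swap12 (i a)) (alt3_swap23 (i a) (i b)) opprK -opprD.
Qed.

Lemma alternation_wedge_tt v : alternation (wedge (i v) t \ox t) = 0.
Proof.
rewrite /wedge tpureBl (linB (@alternation_linear _ _)) !alternationE.
by rewrite (alt3_swap12 (i v)) alt3xx oppr0 subr0.
Qed.

Lemma delta_tensor_incl u :
  tmap delta id (tmap i i u) =
  tmap (tmap i i) i (tmap dg id u) + wedge_slot (tmap D id u).
Proof.
have lw := wedge_slot_linear.
move: u; apply: tensor_linP => [||a b]; try lin.
rewrite /wedge_slot !tmapE; try lin.
by rewrite delta_incl tpureDl.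
Qed.

(** On an antisymmetric [u], [1 (x) D] is minus the flip of [D (x) 1], and
    [alt_t] changes sign under the flip: the two halves of the coderivation
    action become equal after alternation. *)
Lemma alt_t_coder u : exterior_square u ->
  alt_t (tmap D id u + tmap id D u) = alt_t (tmap D id u) + alt_t (tmap D id u).
Proof.
move=> /flip_ext fu; have lT : linear (@tmap K g g g g id D) by lin.
rewrite (linD alt_t_linear); congr (_ + _).
by rewrite -[in LHS](opprK u) -fu (linN lT) -tmap_flip // (linN alt_t_linear)
  alt_t_flip opprK.
Qed.

(** The part of [delta (i x)] inside [g (x) g] contributes the co-Jacobi tensor
    of [dg] and, by [alternation_wedge_slot] and [alt_t_coder], the coderivation
    action with a minus sign.  The part [i (D x) /\ t] contributes
    [delta (i (D x)) (x) t], as [delta t = 0]; this alternates to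
    [alt_t (dg (D x))], since the term with two factors [t] is killed. *)
Lemma co_jacobi_ext x :
  alternation (tmap delta id (delta (i x))) =
  tmap (tmap i i) i (alternation (tmap dg id (dg x)))
  + alt_t (dg (D x) - (tmap D id (dg x) + tmap id D (dg x))).
Proof.
have lT : linear (@tmap K L L _ L delta id) by lin.
have lA := @alternation_linear K L.
rewrite delta_incl (linD lT) (linD lA) delta_tensor_incl (linD lA).
rewrite alternation_tmap ?alternation_wedge_slot; last by lin.
rewrite (linB alt_t_linear) alt_t_coder // -addrA; congr (_ + _).
rewrite addrC; congr (_ + _).
rewrite /wedge (linB lT) !tmapE // delta_t tpure0l subr0 delta_incl tpureDl.
by rewrite (linD lA) alternation_wedge_tt addr0.
Qed.

Lemma delta_zE z : delta z = tmap i i (dg z.1) + wedge (i (D z.1)) t.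
Proof.
by rewrite {1}(extE z) (linD ldelta) (linZ ldelta) delta_t scaler0 addr0.
Qed.

End CoJacobi.

End Extension.

(** * Lie bialgebra structures and pairs *)

Section Correspondence.
Variables (K : fieldType) (g : lieAlgType K).
Local Notation L := (trivial_ext g).
Local Notation i := (@incl K g).
Local Notation p := (@fst g K^o : L -> g).
Local Notation t := (@gen_t K g).

Lemma lie_incl x y : lie (i x) (i y) = i (lie x y).
Proof. by []. Qed.

Section Restriction.
Hypotheses (center0 : lie_center g = [set 0]) (invariants0 : ext_invariants g = [set 0]).
Hypothesis charK0 : [pchar K] =i pred0.
Variable delta : L -> tensor L L.
Hypothesis bialg : lie_bialgebra delta.

Let ldelta : linear delta := cobracket_linear bialg.

Let dg x := tmap p p (delta (i x)).
Let D x := contract_t (delta (i x)).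

(** The cocycle condition on [[z, t] = 0] makes [delta t] invariant; its
    component in the exterior square of [g] then vanishes by the hypothesis on
    invariants, and its contraction along [t] by the hypothesis on the center. *)
Lemma cobracket_gen_t : delta gen_t = 0.
Proof.
have ext_t := cobracket_ext bialg t.
have ad_t z : ad2 z (delta t) = 0.
  have t_z x : lie t x = 0 :> L.
    by rewrite lie_anti; congr pair; rewrite /= ?(lin0 (linear_lier _)) oppr0.
  have z_t : lie z t = 0 by rewrite lie_anti t_z oppr0.
  have := cobracket_cocycle bialg z t; rewrite z_t (lin0 ldelta) => /esym/eqP.
  rewrite subr_eq0 => /eqP ->.
  have -> : ad2 t =1 fun=> 0; last by [].
  apply: tensor_linP => [||a b]; first by lin.
    by move=> a u v; rewrite scaler0 addr0.
  by rewrite /ad2 !tmapE ?t_z ?tpure0l ?tpure0r ?addr0 //; lin.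
have fst0 : tmap p p (delta t) = 0.
  have : ext_invariants g (tmap p p (delta t)).
    split=> [|x]; first by apply: exterior_square_tmap.
    by rewrite -(ad2_tmap (f := p) (i x)) // ad_t lin0 //; lin.
  by rewrite invariants0.
have contract0 : contract_t (delta t) = 0.
  have : lie_center g (contract_t (delta t)).
    move=> x; rewrite lie_anti -(contract_ad2 (i x)) ad_t.
    by rewrite (lin0 (@contract_linear _ _)) oppr0.
  by rewrite center0.
rewrite (exterior_split ext_t) fst0 contract0 lin0; last by lin.
by rewrite add0r (lin0 (f := fun v => wedge (i v) t)) //; lin.
Qed.

Lemma cobracket_incl x : delta (i x) = tmap i i (dg x) + wedge (i (D x)) t.
Proof. exact/exterior_split/(cobracket_ext bialg). Qed.

Let ldg : linear dg.
Proof. by rewrite /dg; lin. Qed.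

Let lD : linear D.
Proof. by have lc := @contract_linear K g; rewrite /D; lin. Qed.

Let dg_ext x : exterior_square (dg x).
Proof. exact/exterior_square_tmap/(cobracket_ext bialg). Qed.

Let co_jacobi_split x :
  tmap (tmap i i) i (alternation (tmap dg id (dg x)))
  + alt_t (dg (D x) - (tmap D id (dg x) + tmap id D (dg x))) = 0.
Proof.
rewrite -(co_jacobi bialg (i x)) (co_jacobi_ext ldg lD ldelta) //.
  exact: cobracket_incl.
exact: cobracket_gen_t.
Qed.

(** Each axiom is the image under a tensor power of the projection to [g] of the
    axiom for [delta]. *)
Lemma restriction_bialgebra : lie_bialgebra dg.
Proof.
split=> // [x|x y].
  have lP : linear (tmap (tmap p p) p) by lin.
  have := co_jacobi_split x => /(congr1 (tmap (tmap p p) p)).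
  by rewrite (linD lP) fst3_incl fst3_alt_t addr0 (lin0 lP).
have lP : linear (tmap p p) by lin.
by rewrite /dg -lie_incl (cobracket_cocycle bialg) (linB lP) !(ad2_tmap (f := p)).
Qed.

(** The derivation rule is the contraction of the cocycle condition along [t].
    For the coderivation rule, the contraction of the co-Jacobi identity gives
    [w - flip w = 0] for the defect [w] of that rule; [w] is antisymmetric, so
    [2 w = 0]. *)
Lemma contraction_biderivation : biderivation dg D.
Proof.
split=> // [x y|x].
  rewrite /D -lie_incl (cobracket_cocycle bialg) (linB (@contract_linear _ _)).
  by rewrite !contract_ad2 /= [lie y _]lie_anti opprK addrC.
have lc := @contract3_linear K g.
have := co_jacobi_split x => /(congr1 (@contract3_t _ _)).
rewrite (linD lc) contract3_incl contract3_alt_t add0r (lin0 lc).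
set w := dg (D x) - _.
have -> : flip w = - w.
  have lf := @flip_linear K g.
  rewrite /w (linB lf) (linD lf) (tmap_flip lD) (tmap_flipr lD) !flip_ext //.
  have lDl : linear (@tmap K g g g g D id) by lin.
  have lDr : linear (@tmap K g g g g id D) by lin.
  by rewrite (linN lDl) (linN lDr) [in RHS]opprB opprB opprK addrC.
rewrite opprK -mulr2n -scaler_nat => /eqP.
rewrite scaler_eq0 (iffLR (pcharf0P _) charK0).
by rewrite subr_eq0 => /eqP.
Qed.

End Restriction.

Section Construction.
Variables (dg : g -> tensor g g) (D : g -> g).
Hypotheses (bialg : lie_bialgebra dg) (bider : biderivation dg D).

Definition ext_cobracket (z : L) : tensor L L :=
  tmap i i (dg z.1) + wedge (i (D z.1)) t.

Let ldg : linear dg := cobracket_linear bialg.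
Let lD : linear D := bider_linear bider.

Lemma ext_cobracket_linear : linear ext_cobracket.
Proof. by rewrite /ext_cobracket; lin. Qed.

Lemma ext_cobracket_gen_t : ext_cobracket t = 0.
Proof.
rewrite /ext_cobracket /= (lin0 ldg) (lin0 lD) lin0 ?add0r; last by lin.
by rewrite (lin0 (f := fun v => wedge (i v) t)) //; lin.
Qed.

Lemma ext_cobracket_bialgebra : lie_bialgebra ext_cobracket.
Proof.
have li : linear i by lin.
split.
- exact: ext_cobracket_linear.
- move=> z; apply: exterior_squareD; last exact: exterior_square_wedge.
  exact/exterior_square_tmap/(cobracket_ext bialg).
- move=> z; have -> : ext_cobracket z = ext_cobracket (i z.1) by [].
  rewrite (co_jacobi_ext ldg lD ext_cobracket_linear) //.
  + rewrite (co_jacobi bialg) (bider_coderivation bider) subrr.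
    rewrite (lin0 (@alt_t_linear _ _)) addr0.
    by apply: lin0; lin.
  + exact: cobracket_ext.
  + exact: ext_cobracket_gen_t.
- move=> z w; rewrite /ext_cobracket /= (cobracket_cocycle bialg).
  have lI : linear (tmap i i) by lin.
  have lt : linear (fun v => wedge (i v) t) by lin.
  rewrite (bider_derivation bider) (linB lI) (linD lt).
  rewrite (linD (ad2_linear z)) (linD (ad2_linear w)) !ad2_incl !ad2_wedge_t.
  rewrite [lie (D _) _]lie_anti (linN lt) [in RHS]opprD [in RHS]addrACA.
  by congr (_ + _); rewrite addrC.
Qed.

End Construction.
End Correspondence.

Unset Implicit Arguments.

Theorem corollary3p4 (K : fieldType) (charK0 : [pchar K] =i pred0)
    (g : lieAlgType K)
    (center0 : lie_center g = [set 0])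
    (invariants0 : ext_invariants g = [set 0]) :
  (* every Lie bialgebra structure on g x K comes from a unique pair *)
  (forall delta : trivial_ext g -> tensor (trivial_ext g) (trivial_ext g),
     lie_bialgebra delta ->
     exists! p : (g -> tensor g g) * (g -> g),
       [/\ lie_bialgebra p.1, biderivation p.1 p.2,
           forall x : g, delta (incl x) =
             tmap (@incl _ g) (@incl _ g) (p.1 x) + wedge (incl (p.2 x)) gen_t
         & delta gen_t = 0])
  /\
  (* every pair comes from a unique Lie bialgebra structure on g x K *)
  (forall (dg : g -> tensor g g) (D : g -> g),
     lie_bialgebra dg -> biderivation dg D ->
     exists! delta : trivial_ext g -> tensor (trivial_ext g) (trivial_ext g),
       [/\ lie_bialgebra delta,
           forall x : g, delta (incl x) =
             tmap (@incl _ g) (@incl _ g) (dg x) + wedge (incl (D x)) gen_t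
         & delta gen_t = 0]).
Proof.
split=> [delta bialg|dg D bialg bider].
  have delta_t := cobracket_gen_t center0 invariants0 bialg.
  exists (fun x => tmap fst fst (delta (incl x)),
          fun x => contract_t (delta (incl x))); split.
    split=> //=; first exact: restriction_bialgebra.
      exact: contraction_biderivation.
    exact: cobracket_incl.
  case=> dg D [/= _ _ delta_incl _]; congr pair; apply: funext => x.
    by rewrite delta_incl split_fst.
  by rewrite delta_incl split_contract.
exists (ext_cobracket dg D); split.
  split=> //; first exact: ext_cobracket_bialgebra.
  exact: ext_cobracket_gen_t.
move=> delta [bialg' delta_incl delta_t]; apply: funext => z.
by rewrite (delta_zE (cobracket_linear bialg') delta_incl delta_t).
Qed.
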